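(* Let $d\ge 2$ and $R\ge1$. Let $C\subseteq\mathbb{R}^d$ be a bounded $R$-fat Borel set and let $S$ be the family of all $2R$-fat Borel subsets of $\mathbb{R}^d$. Then $\mathrm{PropEF}(C,2,S)=\mathrm{Prop}(C,2,S)=1/2$.
   Context: For $R\ge1$, a $d$-dimensional piece (Borel subset of $\mathbb{R}^d$) is $R$-fat if it contains a $d$-dimensional cube $B^-$ and is contained in a $d$-dimensional cube $B^+$ parallel to $B^-$ with $\mathrm{len}(B^+)/\mathrm{len}(B^-)\le R$ (len = side length). A value measure on $C$ is $V(X)=\int_X v$ with $v$ non-negative, bounded, integrable on $C$, $V(C)<\infty$; $V^S(X):=\sup\{V(s):s\in S,s\subseteq X\}$. For $n$ agents with value measures $V_1,\dots,V_n$, an $S$-allocation is $(X_1,\dots,X_n)$ with $X_i\in S$ pairwise disjoint and $\bigcup_i X_i\subseteq C$; it is envy-free if $V_i^S(X_i)\ge V_i^S(X_j)$ for all $i,j$. $\mathrm{PropEF}(C,n,S):=\inf_{V_1,\dots,V_n}\sup_X\min_i V_i(X_i)/V_i(C)$, the infimum over all $n$-tuples of value measures on $C$ and the supremum over envy-free $S$-allocations; $\mathrm{Prop}(C,n,S)$ is defined identically with the supremum over all $S$-allocations. *)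

(* Defs.v *)
From mathcomp Require Import all_boot all_order all_algebra.
From mathcomp Require Import all_classical all_reals all_analysis.
Set Implicit Arguments.
Unset Strict Implicit.
Unset Printing Implicit Defensive.
Import Order.TTheory GRing.Theory Num.Theory.
Import numFieldNormedType.Exports.
Local Open Scope classical_set_scope.
Local Open Scope ring_scope.

(* R^d is modelled as  d.-tuple R, carrying the library's product sigma-algebra
   (generated by the coordinate projections from the Borel sets of R); this is
   exactly the Borel sigma-algebra of R^d.  "Borel subset" = [measurable]. *)

Section FairDivision.
Variables (R : realType) (d : nat).
Local Notation pt := (d.-tuple R).

Definition rowpt (x : pt) : 'rV[R]_d := \row_(i < d) tnth x i.

(* Lebesgue measure on R^d: a measure on the Borel sets giving every closed
   axis-parallel box its volume (this characterizes it uniquely). *)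
Definition is_lebesgue (lam : {measure set pt -> \bar R}) : Prop :=
  forall a b : pt, (forall i, tnth a i <= tnth b i) ->
    lam [set x : pt | forall i, tnth a i <= tnth x i <= tnth b i] =
    (\prod_(i < d) (tnth b i - tnth a i))%:E.

(* closed d-dimensional cube with corner c, side length l, and orientation
   given by the orthonormal rows of Q *)
Definition orthonormal (Q : 'M[R]_d) : Prop := Q *m Q^T = 1%:M.

Definition cube (Q : 'M[R]_d) (c : 'rV[R]_d) (l : R) : set pt :=
  [set x | exists y : 'rV[R]_d,
     (forall i, 0 <= y ord0 i <= l) /\ rowpt x = c + y *m Q].

Definition fat (Rf : R) (X : set pt) : Prop :=
  exists (Q : 'M[R]_d) (cm cp : 'rV[R]_d) (lm lp : R),
    [/\ orthonormal Q, 0 < lm, cube Q cm lm `<=` X, X `<=` cube Q cp lp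
      & lp / lm <= Rf].

Definition bounded_piece (X : set pt) : Prop :=
  exists M : R, forall x, X x -> forall i, `|tnth x i| <= M.

Variable lam : {measure set pt -> \bar R}.

(* v is the density of a value measure on C: non-negative, bounded, integrable
   on C; we also require V(C) > 0 so that V(X)/V(C) is meaningful. *)
Definition value_density (C : set pt) (v : pt -> R) : Prop :=
  [/\ forall x, C x -> 0 <= v x,
      exists M : R, forall x, C x -> v x <= M,
      lam.-integrable C (EFin \o v)
    & (0 < \int[lam]_(x in C) (v x)%:E)%E].

Definition Val (v : pt -> R) (X : set pt) : \bar R :=
  (\int[lam]_(x in X) (v x)%:E)%E.

Definition ValS (S : set pt -> Prop) (v : pt -> R) (X : set pt) : \bar R :=
  ereal_sup [set Val v s | s in [set s | S s /\ s `<=` X]].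

Definition allocation (C : set pt) (S : set pt -> Prop) (n : nat)
    (X : 'I_n -> set pt) : Prop :=
  [/\ forall i, S (X i),
      forall i j, i != j -> X i `&` X j = set0
    & forall i, X i `<=` C].

Definition envy_free (S : set pt -> Prop) (n : nat)
    (v : 'I_n -> pt -> R) (X : 'I_n -> set pt) : Prop :=
  forall i j, (ValS S (v i) (X j) <= ValS S (v i) (X i))%E.

Definition min_ratio (C : set pt) (n : nat)
    (v : 'I_n -> pt -> R) (X : 'I_n -> set pt) : \bar R :=
  ereal_inf [set ((fine (Val (v i) (X i)) / fine (Val (v i) C))%:E)
             | i in [set: 'I_n]].

Definition PropGen (P : forall n, ('I_n -> pt -> R) -> ('I_n -> set pt) -> Prop)
    (C : set pt) (n : nat) (S : set pt -> Prop) : \bar R :=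
  ereal_inf [set ereal_sup [set min_ratio C v X
                           | X in [set X | allocation C S X /\ P n v X]]
            | v in [set v : 'I_n -> pt -> R
                   | forall i, value_density C (v i)]].

Definition PropEF (C : set pt) (n : nat) (S : set pt -> Prop) : \bar R :=
  PropGen (fun n v X => envy_free S v X) C n S.

Definition PropAll (C : set pt) (n : nat) (S : set pt -> Prop) : \bar R :=
  PropGen (fun _ _ _ => True) C n S.

Definition fat_pieces (Rf : R) : set pt -> Prop :=
  fun X => measurable X /\ fat Rf X.

End FairDivision.

(* Main.v *)
From HB Require Import structures.
Require Import Defs.
From mathcomp Require Import all_boot all_order all_algebra.
From mathcomp Require Import all_classical all_reals all_analysis.
From mathcomp Require Import measurable_realfun lra ring.
Set Implicit Arguments.
Unset Strict Implicit.
Unset Printing Implicit Defensive.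
Import Order.TTheory GRing.Theory Num.Theory.
Import numFieldNormedType.Exports.
Local Open Scope classical_set_scope.
Local Open Scope ring_scope.

(** The lower bound is cut-and-choose. Let [B-] be the inner cube and [B+] the
    outer cube of [C]. A piece containing a half-size corner cube of [B-] and
    contained in [B+] is 2R-fat, and so is a suitable part of a cube. The first
    agent halves [C] along a chain of sets growing inside one corner cube of [B-],
    then outside both, then inside the opposite corner cube; the second agent
    chooses.

    Two closed half-size cubes in [B-] meet, so an exact partition of [C] is in
    general impossible: the corner cubes are shrunk by a factor [1 - t], the part of
    [C] near the boundary of [B+] is discarded, and 1/2 is only reached in the limit
    [t -> 0], because the boundary of [B+] is Lebesgue-null. The chain need not be
    continuous in measure: its jumps are filled by slicing the jump sets with
    coordinate hyperplanes, which are null. For the upper bound, give both agents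
    the same density. *)

(** * Sets of prescribed measure between two nested sets *)

Lemma finite_measure_EFin (dd : measure_display) (T : measurableType dd) (R : realType)
    (mu : {measure set T -> \bar R}) (X : set T) :
  (mu setT < +oo)%E -> measurable X -> exists r : R, mu X = r%:E.
Proof.
move=> mufin mX; exists (fine (mu X)); rewrite fineK// ge0_fin_numE//.
by apply: le_lt_trans mufin; apply: le_measure; rewrite ?inE.
Qed.

Section Interpolation.
Context dd (T : measurableType dd) (R : realType).
Variable mu : {measure set T -> \bar R}.
Hypothesis mufin : (mu setT < +oo)%E.

(** The critical parameter is the infimum of the [t] with [c <= mu (A t)]. [U] is the union of the
    chain strictly before it and [L] the intersection strictly after it, both along sequences at
    distance [1/(n+1)], so continuity of [mu] from below and from above gives the two bounds. The
    measure may jump there, hence two sets instead of one. *)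
Lemma measure_quantile (A : R -> set T) (c : \bar R) (t0 t1 : R) :
  (forall t, measurable (A t)) -> {homo A : s t / s <= t >-> s `<=` t} ->
  (mu (A t0) < c)%E -> (c <= mu (A t1))%E ->
  exists (ts : R) (U L : set T),
    [/\ [/\ measurable U, measurable L & U `<=` L],
        (mu U <= c)%E, (c <= mu L)%E,
        forall t, t < ts -> A t `<=` U & forall t, ts < t -> L `<=` A t].
Proof.
move=> mA hA c0 c1.
pose E := [set t | (c <= mu (A t))%E].
have ltE t : E t -> t0 <= t.
  move=> Et; rewrite leNgt; apply/negP => tt0.
  have : (mu (A t) <= mu (A t0))%E by apply: le_measure; rewrite ?inE//; apply/hA/ltW.
  by move/(le_trans Et)/(lt_le_trans c0); rewrite ltxx.
have E1 : E t1 by [].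
have hE : has_inf E by split; [exists t1|exists t0 => t; exact: ltE].
have lowE t : t < inf E -> (mu (A t) < c)%E.
  move=> tE; rewrite ltNge; apply/negP => Et.
  by have := ge_inf hE.2 Et; rewrite leNgt tE.
have upE t : inf E < t -> (c <= mu (A t))%E.
  move=> /(inf_lt hE.1) [s Es st]; apply: le_trans Es _.
  by apply: le_measure; rewrite ?inE//; apply/hA/ltW.
have antiinv (m n : nat) : (m <= n)%N -> n.+1%:R^-1 <= m.+1%:R^-1 :> R.
  by move=> mn; rewrite lef_pV2 ?posrE// ler_nat.
exists (inf E), (\bigcup_n A (inf E - n.+1%:R^-1)), (\bigcap_n A (inf E + n.+1%:R^-1)).
have mU : measurable (\bigcup_n A (inf E - n.+1%:R^-1)) by exact: bigcup_measurable.
have mL : measurable (\bigcap_n A (inf E + n.+1%:R^-1)) by exact: bigcap_measurable.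
split.
- split=> // x [m _ Ax] n _; apply: hA Ax.
  by rewrite lerD2l (@le_trans _ _ 0) ?oppr_le0 ?invr_ge0.
- have h : mu \o (fun n => A (inf E - n.+1%:R^-1)) @ \oo -->
      mu (\bigcup_n A (inf E - n.+1%:R^-1)).
    apply: nondecreasing_cvg_mu => // m n mn; apply/subsetPset/hA.
    by rewrite lerD2l lerN2; exact: antiinv.
  rewrite -(cvg_lim _ h)//; apply: lime_le; first by apply/cvg_ex; eexists; exact: h.
  apply: nearW => n /=; apply/ltW/lowE.
  by rewrite ltrBlDr ltrDl invr_gt0.
- have h : mu \o (fun n => A (inf E + n.+1%:R^-1)) @ \oo -->
      mu (\bigcap_n A (inf E + n.+1%:R^-1)).
    apply: nonincreasing_cvg_mu => //.
      by apply: le_lt_trans mufin; apply: le_measure; rewrite ?inE.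
    by move=> m n mn; apply/subsetPset/hA; rewrite lerD2l; exact: antiinv.
  rewrite -(cvg_lim _ h)//; apply: lime_ge; first by apply/cvg_ex; eexists; exact: h.
  by apply: nearW => n /=; apply: upE; rewrite ltrDl invr_gt0.
- move=> t tE x Ax; have /ltr_add_invr [n hn] := tE.
  by exists n => //; apply: hA Ax; rewrite lerBrDr ltW.
- move=> t tE x Lx; have /ltr_add_invr [n hn] := tE.
  by have := Lx n I; apply: hA; exact: ltW.
Qed.

Variables (h : T -> R) (M : R).
Hypothesis mh : measurable_fun setT h.
Hypothesis hM : mu (~` [set x | - M <= h x <= M]) = 0%E.
Hypothesis h0 : forall s, mu [set x | h x = s] = 0%E.

Let mle t : measurable [set x | h x <= t].
Proof.
rewrite [X in measurable X](_ : _ = h @^-1` `]-oo, t]%classic).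
  by rewrite -[X in measurable X]setTI; exact: mh.
by apply/seteqP; split=> x /=; rewrite in_itv.
Qed.

Let meq t : measurable [set x | h x = t].
Proof. by rewrite -[X in measurable X]setTI; exact: (mh measurableT (measurable_set1 t)). Qed.

(** [L] is swept by the sublevel sets of [h], starting from [U]. Since the level sets of [h] are
    null, this chain has no jump, so its quantile has measure exactly [c]. *)
Lemma measure_sandwich (U L : set T) (c : \bar R) :
  measurable U -> measurable L -> U `<=` L -> (mu U <= c)%E -> (c <= mu L)%E ->
  exists K, [/\ measurable K, U `<=` K, K `<=` L & mu K = c].
Proof.
move=> mU mL UL; rewrite le_eqVlt => /orP[/eqP <-|Uc] cL; first by exists U; split.
pose A t := U `|` (L `&` [set x | h x <= t]).
have mA t : measurable (A t) by apply: measurableU => //; exact: measurableI mL (mle _).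
have hA : {homo A : s t / s <= t >-> s `<=` t}.
  by move=> s t st x [Ux|[Lx] /= hx]; [left|right; split=> //=; exact: le_trans st].
have nullM B : measurable B -> B `<=` ~` [set x | - M <= h x <= M] -> mu B = 0%E.
  move=> mB BM; apply: (subset_measure0 mB _ BM hM).
  rewrite (_ : [set _ | _] = h @^-1` `[- M, M]%classic).
    by apply: measurableC; rewrite -[X in measurable X]setTI; exact: mh.
  by apply/seteqP; split=> x /=; rewrite in_itv.
(* Almost everywhere [h] lies in [[-M, M]], so up to null sets the chain is [U] at [-M - 1] and all
   of [L] at [M]. *)
have A0 : (mu (A (- M - 1)%R) < c)%E.
  rewrite measureU0//; first exact: measurableI mL (mle _).
  apply: nullM; first exact: measurableI mL (mle _).
  by move=> x [_ /= hx] /andP[]; lra.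
have A1 : (c <= mu (A M))%E.
  have LE : mu L = (mu (L `\` [set x | (h x <= M)%R]) + mu (L `&` [set x | (h x <= M)%R]))%E.
    exact: (measureDI mu mL (mle M)).
  apply: le_trans cL _; rewrite LE (nullM (L `\` _)) ?add0e.
  - by apply: le_measure; rewrite ?inE//; [exact: measurableI mL (mle _)|right].
  - exact: measurableD mL (mle _).
  - by move=> x [_ /= /negP]; rewrite -ltNge => hx /andP[]; lra.
have [ts [U' [L' [[mU' mL' UL'] U'c cL' lo up]]]] := measure_quantile mA hA A0 A1.
exists U'; split=> //.
- by apply: subset_trans (lo (ts - 1) _); [left|lra].
- apply: (subset_trans UL'); apply: (subset_trans (up (ts + 1) _)); first lra.
  by move=> x [/UL|[]].
- apply/eqP; rewrite eq_le U'c/=; apply: (le_trans cL').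
  have LE : mu L' = (mu (L' `\` U') + mu (L' `&` U'))%E.
    exact: (measureDI mu mL' mU').
  rewrite LE (setIidr UL') (_ : mu (L' `\` U') = 0)%E ?add0e//.
  (* A point of the gap lies in [A (ts + e)] for every [e > 0] and in no [A (ts - e)], which forces
     [h x = ts]. *)
  apply: (subset_measure0 (measurableD mL' mU') (meq ts) _ (h0 ts)) => x [Lx Ux] /=.
  apply/eqP; rewrite eq_le; apply/andP; split; apply/ler_addgt0Pr => e e0.
  + have [Ux'|[_ //]] : A (ts + e) x by apply: up Lx; rewrite ltrDl.
    by exfalso; apply: Ux; apply: (lo (ts - 1)); [lra|left].
  + rewrite leNgt; apply/negP => hx; apply: Ux; apply: (lo (ts - e)); first lra.
    have [?|[? _]] : A (ts + e) x by apply: up Lx; rewrite ltrDl.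
      by left.
    by right; split=> //=; lra.
Qed.

End Interpolation.

Lemma measurable_forall (dd : measure_display) (T : measurableType dd) (I : finType)
    (F : I -> set T) :
  (forall i, measurable (F i)) -> measurable [set x | forall i, F i x].
Proof.
move=> mF; rewrite (_ : [set x | _] = \bigcap_(i in setT) F i).
  by apply: fin_bigcap_measurable => //; exact: finite_finset.
by apply/seteqP; split=> x /= hx i => [_|]; apply: hx.
Qed.

(** * Hyperplanes are Lebesgue-null *)

Section Hyperplanes.
Context (R : realType) (d : nat).
Variable lam : {measure set (d.-tuple R) -> \bar R}.
Hypothesis lamL : is_lebesgue lam.

Definition closed_box (a b : 'I_d -> R) : set (d.-tuple R) :=
  [set x | forall i, a i <= tnth x i <= b i].

Lemma measurable_closed_box a b : measurable (closed_box a b).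
Proof.
apply: (@measurable_forall _ _ _ (fun i => [set x | a i <= tnth x i <= b i])) => i.
rewrite (_ : [set x | _] = (@tnth d R)^~ i @^-1` `[a i, b i]%classic).
  by rewrite -[X in measurable X]setTI; exact: measurable_tnth.
by apply/seteqP; split=> x /=; rewrite in_itv.
Qed.

Lemma lebesgue_closed_box a b : (forall i, a i <= b i) ->
  lam (closed_box a b) = (\prod_(i < d) (b i - a i))%:E.
Proof.
move=> ab; have := lamL (a := [tuple a i | i < d]) (b := [tuple b i | i < d]).
rewrite (eq_bigr (fun i => b i - a i)); last by move=> i _; rewrite !tnth_mktuple.
move=> <-; last by move=> i; rewrite !tnth_mktuple.
by congr (lam _); apply/seteqP; split=> x /= hx i; have := hx i; rewrite !tnth_mktuple.
Qed.

Definition hyperplane (q : 'I_d -> R) (a : R) : set (d.-tuple R) :=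
  [set x | \sum_i q i * tnth x i = a].

Lemma measurable_linear_form (q : 'I_d -> R) :
  measurable_fun setT (fun x : d.-tuple R => \sum_i q i * tnth x i).
Proof.
by apply: measurable_sum => i; apply: measurable_funM => //; exact: measurable_tnth.
Qed.

Lemma measurable_hyperplane q a : measurable (hyperplane q a).
Proof.
rewrite -[X in measurable X]setTI.
exact: (measurable_linear_form q measurableT (measurable_set1 a)).
Qed.

Lemma grid_cell (n : nat) (a w u : R) : a <= u <= a + w ->
  exists j : 'I_n.+1,
    a + j%:R * (w / n.+1%:R) <= u <= a + j%:R * (w / n.+1%:R) + w / n.+1%:R.
Proof.
move=> /andP[au uw]; have w0 : 0 <= w by lra.
have [w00|wn0] := eqVneq w 0.
  by exists ord0; rewrite w00 !mul0r ?mulr0 !addr0; lra.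
have wp : 0 < w by rewrite lt_neqAle eq_sym wn0.
pose h := w / n.+1%:R; have hp : 0 < h by rewrite divr_gt0.
have hw : h *+ n.+1 = w by rewrite -mulr_natr divfK.
(* At the right end point [(u - a) / h] truncates to [n.+1], one too many, so the last cell is
   treated apart. *)
have [un|un] := ltP u (a + n%:R * h); last first.
  exists ord_max; rewrite /= -/h un/= -addrA.
  by have -> : n%:R * h + h = w by rewrite -hw mulrSr mulr_natl.
have t0 : 0 <= (u - a) / h by rewrite divr_ge0 ?subr_ge0// ltW.
have := truncn_itv t0; set m := Num.truncn _ => /andP[m1 m2].
have mn : (m < n.+1)%N.
  rewrite ltnS -(ler_nat R) ltW// (le_lt_trans m1)// ltr_pdivrMr//; lra.
exists (Ordinal mn) => /=; rewrite -/h.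
move: m1 m2; rewrite ler_pdivlMr// ltr_pdivrMr// -natr1 mulrDl mul1r; lra.
Qed.

(* With N = n.+1, the region is covered by N^d boxes: N^(d-1) columns over the grid
   cells in the coordinates other than [k], in each of which [tnth x k] varies by
   O(1/N), each column being cut into N slices so that all boxes are indexed by
   functions ['I_d -> 'I_N]. *)
Lemma hyperplane_box_le (q : 'I_d -> R) (k : 'I_d) (a M : R) : q k != 0 -> 0 <= M ->
  exists K : R, 0 <= K /\ forall n : nat,
    (lam (hyperplane q a `&` closed_box (fun=> (- M)%R) (fun=> M)) <= (K / n.+1%:R)%:E)%E.
Proof.
move=> qk M0.
(* Along the hyperplane, [tnth x k] is a Lipschitz function of the other coordinates with constant
   [L] for the sup norm. *)
pose L := \sum_(i | i != k) `|q i| / `|q k|.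
have L0 : 0 <= L by apply: sumr_ge0 => i _; rewrite divr_ge0.
pose w := M + M.
have w0 : 0 <= w by rewrite addr_ge0.
exists (2 * L * w * \prod_(i < d | i != k) w); split.
  by rewrite mulr_ge0 ?prodr_ge0// !mulr_ge0.
move=> n; pose N : R := n.+1%:R; pose h := w / N.
have N0 : 0 < N by [].
have h0 : 0 <= h by rewrite divr_ge0// ltW.
(* [p f] is the lower corner of the grid cell [f], and [phi f] the height of the hyperplane above
   it. Over the cell the height stays within [L * h] of [phi f]; this window of length [2 * L * h]
   is cut into [N] slices of length [len k]. *)
pose p (f : {ffun 'I_d -> 'I_n.+1}) i := - M + (f i)%:R * h.
pose phi f := (a - \sum_(i | i != k) q i * p f i) / q k.
pose len i := (if i == k then 2 * L * h else w) / N.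
pose lo f i := if i == k then phi f - L * h + (f k)%:R * len k else p f i.
have len0 i : 0 <= len i.
  by rewrite /len; case: ifP => _; rewrite !mulr_ge0// invr_ge0 ltW.
set S := _ `&` _.
have mS : measurable S.
  by apply: measurableI; [exact: measurable_hyperplane|exact: measurable_closed_box].
have SU : S `<=` \bigcup_(f in [set: {ffun 'I_d -> 'I_n.+1}])
    closed_box (lo f) (fun i => lo f i + len i).
  move=> x [/= Hx Bx].
  have /fin_all_exists [f0 hf0] : forall i, exists j : 'I_n.+1,
      - M + j%:R * h <= tnth x i <= - M + j%:R * h + h.
    by move=> i; apply: grid_cell; have := Bx i; rewrite /w; lra.
  pose g := [ffun i => f0 i].
  have xk : `|tnth x k - phi g| <= L * h.
    have -> : tnth x k - phi g = \sum_(i | i != k) (q i * (p g i - tnth x i)) / q k.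
      rewrite -mulr_suml; apply: (mulIf qk); rewrite divfK// mulrBl divfK//.
      rewrite -Hx (bigD1 k)//= opprB; under [RHS]eq_bigr do rewrite mulrBr.
      rewrite sumrB; ring.
    apply: (le_trans (ler_norm_sum _ _ _)); rewrite /L mulr_suml.
    apply: ler_sum => i _; rewrite normrM normfV normrM mulrAC.
    rewrite ler_wpM2l ?divr_ge0//.
    by rewrite /p ffunE ler_norml; have := hf0 i; lra.
  have [j hj] : exists j : 'I_n.+1, phi g - L * h + j%:R * len k <= tnth x k <=
      phi g - L * h + j%:R * len k + len k.
    rewrite /len eqxx; apply: grid_cell.
    by move: xk; rewrite ler_norml; lra.
  (* The entry at [k] becomes the slice number; [phi] does not read it, so the column is
     unchanged. *)
  pose f := [ffun i => if i == k then j else f0 i].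
  have pf i : i != k -> p f i = p g i.
    by move=> ik; rewrite /p !ffunE (negbTE ik).
  have phif : phi f = phi g.
    by congr ((_ - _) / _); apply: eq_bigr => i ik; rewrite pf.
  exists f => // i; rewrite /lo; have [->|ik] := eqVneq i k.
    by rewrite phif ffunE eqxx.
  by rewrite pf// /p ffunE /len (negbTE ik); exact: hf0.
have := content_sub_fsum lam finite_finset (fun f _ => measurable_closed_box _ _) mS SU.
move=> /le_trans; apply.
rewrite (_ : [set: _] = [set` enum {ffun 'I_d -> 'I_n.+1}]); last first.
  by apply/seteqP; split=> f //= _; rewrite mem_enum.
rewrite -fsbig_seq ?enum_uniq// big_enum /=.
under eq_bigr => f _.
  rewrite lebesgue_closed_box; last by move=> i; rewrite lerDl.
  under eq_bigr do rewrite addrAC subrr add0r.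
over.
rewrite sumEFin lee_fin sumr_const card_ffun !card_ord.
(* The number [N^d] of boxes cancels the factors [1/N] in the lengths; the [1/N] that remains is the
   one in [h = w / N]. *)
rewrite -[leLHS]mulr_natl natrX -/N.
rewrite big_split/= prodr_const card_ord exprVn mulrCA mulfV ?mulr1 ?expf_neq0 ?gt_eqF//.
rewrite (bigD1 k)//= eqxx (eq_bigr (fun=> w)); last by move=> i /negbTE->.
by rewrite /h mulrA mulrAC.
Qed.

(** The boxes [[-n, n]^d] exhaust the space, and within each of them the bound [K/N] holds for every
    [N]. *)
Lemma hyperplane_null (q : 'I_d -> R) (a : R) : (exists k, q k != 0) ->
  lam (hyperplane q a) = 0%E.
Proof.
move=> [k qk].
apply: (measure_negligible (measurable_hyperplane q a)).
pose B n := closed_box (fun=> - n%:R) (fun=> n%:R).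
rewrite (_ : hyperplane q a = \bigcup_n (hyperplane q a `&` B n)).
  apply: negligible_bigcup => n; apply/negligibleP.
    by apply: measurableI; [exact: measurable_hyperplane|exact: measurable_closed_box].
  have [K [K0 hK]] := hyperplane_box_le a qk (ler0n R n).
  apply/eqP; rewrite -measure_le0; apply/lee_addgt0Pr => e e0; rewrite add0e.
  apply: (le_trans (hK (Num.truncn (K / e)))); rewrite lee_fin.
  rewrite ler_pdivrMr// mulrC -ler_pdivrMr//; apply/ltW.
  by rewrite truncnS_gt.
apply/seteqP; split=> [x Hx|x [n _ [//]]].
pose m := \sum_i `|tnth x i|.
exists (Num.truncn m).+1 => //; split=> //= i.
rewrite -ler_norml; apply: (@le_trans _ _ m).
  by rewrite /m (bigD1 i)//= lerDl sumr_ge0.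
by apply/ltW; exact: truncnS_gt.
Qed.

End Hyperplanes.

(** * Cubes and fatness in rotated coordinates *)

Section Cubes.
Context (R : realType) (d : nat).
Local Notation pt := (d.-tuple R).
Local Notation orthonormal := (@Defs.orthonormal R d).

Definition rot_coord (Q : 'M[R]_d) (i : 'I_d) (x : pt) : R :=
  \sum_j Q i j * tnth x j.

(** For orthonormal [Q], the map [y *m Q] is inverted by [Q^T]. Passing to the coordinates
    [rot_coord] therefore turns the existential in [cube] into plain inequalities, with the corner
    expressed in the same coordinates. *)
Definition rot_cube (Q : 'M[R]_d) (z : 'I_d -> R) (l : R) : set pt :=
  [set x | forall i, z i <= rot_coord Q i x <= z i + l].

Lemma rot_coordE Q i x : rot_coord Q i x = (rowpt x *m Q^T) ord0 i.
Proof. by rewrite mxE; apply: eq_bigr => j _; rewrite !mxE mulrC. Qed.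

Lemma rot_coord_surj Q (z : 'rV[R]_d) : orthonormal Q ->
  exists x, rowpt x = z *m Q /\ forall i, rot_coord Q i x = z ord0 i.
Proof.
move=> QQ; pose x := [tuple (z *m Q) ord0 i | i < d].
have xE : rowpt x = z *m Q by apply/rowP => i; rewrite mxE tnth_mktuple.
by exists x; split=> // i; rewrite rot_coordE xE -mulmxA QQ mulmx1.
Qed.

Lemma cubeE Q c l : orthonormal Q ->
  cube Q c l = rot_cube Q (fun i => (c *m Q^T) ord0 i) l.
Proof.
move=> QQ; apply/seteqP; split=> x.
  move=> [y [yl xE]] i; rewrite rot_coordE xE mulmxDl -mulmxA QQ mulmx1 /=.
  move: (c *m Q^T) => u; rewrite mxE.
  by have /=  := yl i; lra.
move=> hx; exists ((rowpt x - c) *m Q^T); split.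
  move=> i; have := hx i; rewrite rot_coordE mulmxBl /=.
  by move: (c *m Q^T) (rowpt x *m Q^T) => u v; rewrite !mxE /=; lra.
by rewrite -mulmxA (mulmx1C QQ) mulmx1 addrC subrK.
Qed.

Lemma fatP Rf (X : set pt) : fat Rf X <->
  exists Q zm zp lm lp, [/\ orthonormal Q, 0 < lm, rot_cube Q zm lm `<=` X,
    X `<=` rot_cube Q zp lp & lp / lm <= Rf].
Proof.
split.
  move=> [Q [cm [cp [lm [lp [QQ lm0 mX Xp r]]]]]].
  by exists Q, (fun i => (cm *m Q^T) ord0 i), (fun i => (cp *m Q^T) ord0 i), lm, lp;
     rewrite -!cubeE.
move=> [Q [zm [zp [lm [lp [QQ lm0 mX Xp r]]]]]].
exists Q, (\row_i zm i *m Q), (\row_i zp i *m Q), lm, lp; rewrite !cubeE//.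
have zE (z : 'I_d -> R) : (fun i => (\row_i z i *m Q *m Q^T) ord0 i) = z.
  by apply/funext => i; rewrite -mulmxA QQ mulmx1 mxE.
by rewrite !zE.
Qed.

Lemma fat_le Rf Rf' (X : set pt) : Rf <= Rf' -> fat Rf X -> fat Rf' X.
Proof.
move=> RR [Q [cm [cp [lm [lp [QQ lm0 mX Xp r]]]]]].
by exists Q, cm, cp, lm, lp; split=> //; exact: le_trans RR.
Qed.

(** The inclusion is tested at two opposite corners of the inner cube. *)
Lemma rot_cube_corner Q zm zp lm lp : orthonormal Q -> 0 <= lm ->
  rot_cube Q zm lm `<=` rot_cube Q zp lp ->
  forall i, zp i <= zm i /\ zm i + lm <= zp i + lp.
Proof.
move=> QQ lm0 mp i.
have [x [_ xE]] := rot_coord_surj (\row_i zm i) QQ.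
have [y [_ yE]] := rot_coord_surj (\row_i (zm i + lm)) QQ.
have /mp/(_ i) : rot_cube Q zm lm x by move=> j; rewrite xE mxE; lra.
have /mp/(_ i) : rot_cube Q zm lm y by move=> j; rewrite yE mxE; lra.
by rewrite xE yE !mxE; lra.
Qed.

Lemma orthonormal_row_neq0 Q i : orthonormal Q -> exists j, Q i j != 0.
Proof.
move=> QQ; apply/existsP; rewrite -negb_forall; apply/negP => /forallP Q0.
have : (Q *m Q^T) i i = 0.
  by rewrite mxE big1// => j _; move/eqP: (Q0 j) => ->; rewrite mul0r.
by rewrite QQ mxE eqxx => /eqP; rewrite oner_eq0.
Qed.

Lemma measurable_rot_coord Q i : measurable_fun setT (rot_coord Q i).
Proof. exact: measurable_linear_form. Qed.

Lemma measurable_rot_cube Q z l : measurable (rot_cube Q z l).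
Proof.
apply: (@measurable_forall _ _ _ (fun i => [set x | z i <= rot_coord Q i x <= z i + l])) => i.
rewrite (_ : [set x | _] = rot_coord Q i @^-1` `[z i, z i + l]%classic).
  by rewrite -[X in measurable X]setTI; exact: (measurable_rot_coord Q i).
by apply/seteqP; split=> x /=; rewrite in_itv.
Qed.

(** * Cutting off fat pieces of prescribed measure *)

Section Cut.
(** The measure is abstract because [equal_cut] uses a sum of two restrictions of a value measure.
    What is kept is finiteness, null hyperplanes and bounded support. *)
Variable mu : {measure set pt -> \bar R}.
Hypothesis mufin : (mu setT < +oo)%E.
Hypothesis mu_hyperplane : forall q a, (exists k, q k != 0) ->
  mu (hyperplane q a) = 0%E.
Variable M : R.
Hypothesis muM : mu (~` closed_box (fun=> - M) (fun=> M)) = 0%E.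
Hypothesis d0 : (0 < d)%N.

Lemma rot_coord_null Q i s : orthonormal Q -> mu [set x | rot_coord Q i x = s] = 0%E.
Proof. by move=> QQ; apply: mu_hyperplane; exact: orthonormal_row_neq0. Qed.

(** [measure_sandwich] with a coordinate function as [h]: its level sets are hyperplanes. *)
Lemma set_between (U L : set pt) (c : \bar R) :
  measurable U -> measurable L -> U `<=` L -> (mu U <= c)%E -> (c <= mu L)%E ->
  exists K, [/\ measurable K, U `<=` K, K `<=` L & mu K = c].
Proof.
have i0 := Ordinal d0.
have h0 s : mu [set x | tnth x i0 = s] = 0%E.
  rewrite (_ : [set x | _] = hyperplane (fun j => (j == i0)%:R) s).
    by apply: mu_hyperplane; exists i0; rewrite /= eqxx oner_neq0.
  apply: eq_set => x; rewrite (bigD1 i0)//=. rewrite eqxx mul1r big1 ?addr0//.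
  by move=> j /negbTE ->; rewrite mul0r.
apply: (measure_sandwich (M := M) mufin (measurable_tnth i0) _ h0).
have mB := measurable_closed_box (fun=> - M) (fun=> M : R) : measurable (closed_box (d := d) _ _).
apply: (subset_measure0 _ _ _ muM); last by move=> x /= hx hB; apply: hx; exact: hB.
  apply: measurableC; rewrite (_ : [set _ | _] = (@tnth d R)^~ i0 @^-1` `[- M, M]%classic).
    by rewrite -[X in measurable X]setTI; exact: measurable_tnth.
  by apply/seteqP; split=> x /=; rewrite in_itv.
exact: measurableC.
Qed.

(** Cubes grow from the corner [z]. At the critical side [ts] the piece is squeezed between cubes of
    side just below and just above [ts], so its fatness can be brought as near to 1 as desired; 2 is
    enough. *)
Lemma cube_piece Q z l (c : \bar R) : orthonormal Q -> 0 < l ->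
  (0 < c)%E -> (c <= mu (rot_cube Q z l))%E ->
  exists L, [/\ measurable L, L `<=` rot_cube Q z l, fat 2 L & mu L = c].
Proof.
move=> QQ l0 c0; rewrite le_eqVlt => /orP[/eqP ->|cl].
  exists (rot_cube Q z l); split=> //; first exact: measurable_rot_cube.
  by apply/fatP; exists Q, z, z, l, l; split=> //; rewrite divff ?gt_eqF// ler1n.
have i0 := Ordinal d0.
(* The cap at [l] keeps the chain inside the given cube; for negative [t] the cube is empty. *)
pose A t := rot_cube Q z (Num.min t l).
have mA t : measurable (A t) by exact: measurable_rot_cube.
have sub s t : s <= t -> rot_cube Q z s `<=` rot_cube Q z t.
  by move=> st x hx i; have := hx i; lra.
have hA : {homo A : s t / s <= t >-> s `<=` t}.
  by move=> s t st; apply: sub; rewrite le_min !ge_min st lexx orbT.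
have A0 : (mu (A (-1)%R) < c)%E.
  rewrite (_ : A (-1) = set0) ?measure0// -subset0 => x /(_ i0).
  by rewrite min_l; lra.
have A1 : (c <= mu (A l))%E by rewrite /A minxx ltW.
have [ts [U [L [[mU mL UL] Uc cL lo up]]]] := measure_quantile mufin mA hA A0 A1.
(* Otherwise [L] would lie in the face [rot_coord Q i0 x = z i0], which is null, although
   [0 < c <= mu L]. *)
have ts0 : 0 < ts.
  rewrite ltNge; apply/negP => ts0; move: cL; apply/negP; rewrite -ltNge.
  rewrite (_ : mu L = 0)%E//; apply: (subset_measure0 mL _ _ (rot_coord_null i0 (z i0) QQ)).
    exact: measurable_hyperplane.
  move=> x Lx /=; apply/eqP; rewrite eq_le; apply/andP; split.
    apply/ler_addgt0Pr => e e0; have /(_ i0) : A e x by apply: up Lx; lra.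
    by move=> /andP[_ /le_trans]; apply; rewrite lerD2l ge_min lexx.
  by have /(_ i0)/andP[] : A 1 x by apply: up Lx; lra.
(* Otherwise the whole cube lies in [U], against [mu U <= c] and the strict inequality
   [c < mu (rot_cube Q z l)]. *)
have tsl : ts <= l.
  rewrite leNgt; apply/negP => /lo lU; move: cl; apply/negP; rewrite -leNgt.
  apply: le_trans Uc; apply: le_measure; rewrite ?inE//; first exact: measurable_rot_cube.
  by move: lU; rewrite /A minxx.
have [K [mK UK KL muK]] := set_between mU mL UL Uc cL.
exists K; split=> //.
  apply: (subset_trans KL); apply: (subset_trans (up (ts + 1) _)); first lra.
  by apply: sub; rewrite ge_min lexx orbT.
(* The inner side is below [ts <= l], so the cap does not affect it; the ratio is [5/3]. *)
apply/fatP; exists Q, z, z, (3 / 4 * ts), (5 / 4 * ts); split=> //; first lra.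
- apply: subset_trans UK; apply: subset_trans (lo (3 / 4 * ts) _); last lra.
  by apply: sub; rewrite le_min lexx; lra.
- apply: (subset_trans KL); apply: (subset_trans (up (5 / 4 * ts) _)); first lra.
  by apply: sub; rewrite ge_min lexx.
- rewrite ler_pdivrMr; lra.
Qed.

(* The two pieces of an allocation will be [K `&` Y1] and [Y2 `\` K]. *)
Lemma fat_cut (Rf : R) Q z1 z2 w1 w2 s l (Y1 Y2 : set pt) (c1 c2 : \bar R) :
  orthonormal Q -> 1 <= Rf -> 0 < s -> l / s <= 2 * Rf ->
  measurable Y1 -> measurable Y2 ->
  rot_cube Q z1 s `<=` Y1 -> Y1 `<=` rot_cube Q w1 l ->
  rot_cube Q z2 s `<=` Y2 -> Y2 `<=` rot_cube Q w2 l ->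
  rot_cube Q z1 s `&` rot_cube Q z2 s = set0 ->
  (0 < c1)%E -> (0 < c2)%E -> (mu setT = c1 + c2)%E ->
  exists K, [/\ measurable K, mu K = c2, fat (2 * Rf) (K `&` Y1)
                & fat (2 * Rf) (Y2 `\` K)].
Proof.
set Q1 := rot_cube Q z1 s; set Q2 := rot_cube Q z2 s.
move=> QQ Rf1 s0 ls mY1 mY2 QY1 YB1 QY2 YB2 Q12 c10 c20 muT.
have mQ1 : measurable Q1 by exact: measurable_rot_cube.
have mQ2 : measurable Q2 by exact: measurable_rot_cube.
have Q1C : Q1 `<=` ~` Q2 by move=> x q1 q2; have : set0 x by rewrite -Q12.
have Q2C : Q2 `<=` ~` Q1 by move=> x q2 q1; have : set0 x by rewrite -Q12.
have fat2 (X : set pt) : fat 2 X -> fat (2 * Rf) X by apply: fat_le; lra.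
have fatY1 (X : set pt) : Q1 `<=` X -> X `<=` Y1 -> fat (2 * Rf) X.
  move=> QX XY; apply/fatP; exists Q, z1, w1, s, l; split=> //.
  exact: subset_trans YB1.
have fatY2 (X : set pt) : Q2 `<=` X -> X `<=` Y2 -> fat (2 * Rf) X.
  move=> QX XY; apply/fatP; exists Q, z2, w2, s, l; split=> //.
  exact: subset_trans YB2.
have muC (X : set pt) : measurable X -> (mu X + mu (~` X))%E = mu setT.
  move=> mX; rewrite -measureU//; [by rewrite setUv|exact: measurableC|by rewrite setICr].
have fin (X : set pt) : measurable X -> exists r, mu X = r%:E.
  exact: finite_measure_EFin mufin.
have cfin (c c' : \bar R) : (0 < c)%E -> (0 < c')%E -> (mu setT = c + c')%E ->
    exists r, c = r%:E.
  move=> cp cp' cc'; exists (fine c); rewrite fineK// ge0_fin_numE ?ltW//.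
  by apply: le_lt_trans mufin; rewrite cc' leeDl// ltW.
have [r1 c1E] := cfin _ _ c10 c20 muT.
have [r2 c2E] := cfin _ _ c20 c10 (eq_trans muT (addeC _ _)).
(* If [Q1] is worth at least [c2], then [K] is a 2-fat part of [Q1], and the other piece still
   contains [Q2]. *)
have [c2Q1|Q1c2] := leP c2 (mu Q1).
  have [K [mK KQ fK muK]] := cube_piece QQ s0 c20 c2Q1.
  exists K; split=> //.
  - by rewrite setIidl; [exact: fat2|exact: subset_trans QY1].
  - apply: fatY2 => [x q2|]; last exact: subDsetl.
    by split; [exact: QY2|move=> /KQ; exact: Q2C].
(* Symmetric case: the complement of [K] is a 2-fat part of [Q2]. *)
have [c1Q2|Q2c1] := leP c1 (mu Q2).
  have [L [mL LQ fL muL]] := cube_piece QQ s0 c10 c1Q2.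
  exists (~` L); split.
  - exact: measurableC.
  - have := muC _ mL; have [a ->] := fin _ (measurableC mL).
    by rewrite muL muT c1E c2E => -[/addrI ->].
  - apply: fatY1 => [x q1|]; last exact: subIsetr.
    by split; [move=> /LQ; exact: Q1C|exact: QY1].
  - rewrite setDE setCK setIidr; first exact: fat2.
    exact: subset_trans QY2.
(* In the remaining case [K] contains [Q1] and avoids [Q2], so each piece contains its own corner
   cube. *)
have c2Q2 : (c2 <= mu (~` Q2))%E.
  have := muC _ mQ2; have [a ->] := fin _ (measurableC mQ2); move: Q2c1.
  have [b ->] := fin _ mQ2; rewrite muT c1E c2E lte_fin lee_fin => h [h']; lra.
have [K [mK QK KQ muK]] := set_between mQ1 (measurableC mQ2) Q1C (ltW Q1c2) c2Q2.
exists K; split=> //.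
- apply: fatY1; [|exact: subIsetr] => x q1; split; [exact: QK|exact: QY1].
- apply: fatY2; [|exact: subDsetl] => x q2; split; first exact: QY2.
  by move=> /KQ.
Qed.

End Cut.
End Cubes.

(** * Halving a fat set up to a small waste near the boundary *)

Section Halving.
Context (R : realType) (d : nat).
Local Notation pt := (d.-tuple R).
Local Notation orthonormal := (@Defs.orthonormal R d).
Variable W : {measure set pt -> \bar R}.
Hypothesis Wfin : (W setT < +oo)%E.
Hypothesis W_hyperplane : forall q a, (exists k, q k != 0) ->
  W (hyperplane q a) = 0%E.
Variable M : R.
Hypothesis WM : W (~` closed_box (fun=> - M) (fun=> M)) = 0%E.
Hypothesis d0 : (0 < d)%N.
Variables (Q : 'M[R]_d) (zm zp : 'I_d -> R) (lm lp Rf : R) (C : set pt).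
Hypotheses (QQ : orthonormal Q) (lm0 : 0 < lm) (mC : measurable C).
Hypotheses (mQC : rot_cube Q zm lm `<=` C) (CQp : C `<=` rot_cube Q zp lp).

(** The outer cube with a margin [e * lp] removed on every side. For [e = t] it lies in both
    shrunken outer cubes of [equal_cut], so no point of [C] in it is discarded. *)
Definition core (e : R) : set pt :=
  rot_cube Q (fun i => zp i + e * lp) (lp - 2 * (e * lp)).

Let corner : forall i, zp i <= zm i /\ zm i + lm <= zp i + lp.
Proof. exact: rot_cube_corner QQ (ltW lm0) (subset_trans mQC CQp). Qed.

Let lp0 : 0 < lp.
Proof. by have [h1 h2] := corner (Ordinal d0); apply: (lt_le_trans lm0); lra. Qed.

Let fin (X : set pt) : measurable X -> exists r, W X = r%:E.
Proof. exact: finite_measure_EFin Wfin. Qed.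

(** As the margin shrinks, [C] minus the core decreases to a part of the faces of the outer cube,
    which are null; continuity from above concludes. *)
Lemma core_waste (e : R) : 0 < e -> exists e0, 0 < e0 < 1 /\
  forall t, 0 < t <= e0 -> (W (C `\` core t) <= e%:E)%E.
Proof.
(* Margins start at [1/2], so that the resulting [e0] is below 1. *)
move=> e_gt0; pose D n := C `\` core n.+2%:R^-1.
have core_le s t : s <= t -> core t `<=` core s.
  move=> st x hx i; have := hx i.
  have : s * lp <= t * lp by rewrite ler_wpM2r// ltW.
  move: (s * lp) (t * lp) => a b; lra.
have mD n : measurable (D n) by apply: measurableD => //; exact: measurable_rot_cube.
have mDI : measurable (\bigcap_n D n) by exact: bigcap_measurable.
have inv_le (m n : nat) : (m <= n)%N -> n.+2%:R^-1 <= m.+2%:R^-1 :> R.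
  by move=> mn; rewrite lef_pV2 ?posrE// ler_nat ltnS.
pose face i := [set x | rot_coord Q i x = zp i] `|` [set x | rot_coord Q i x = zp i + lp].
have mface i : measurable (face i).
  by apply: measurableU; exact: measurable_hyperplane.
have face0 i : W (face i) = 0%E.
  rewrite measureU0; first exact: rot_coord_null.
  - exact: measurable_hyperplane.
  - exact: measurable_hyperplane.
  - exact: rot_coord_null.
have DI : \bigcap_n D n `<=` \bigcup_(i in [set: 'I_d]) face i.
  move=> x Dx; apply: contrapT => nf.
  have gap i : exists k : nat, forall n, (k <= n)%N ->
      zp i + n.+2%:R^-1 * lp <= rot_coord Q i x <= zp i + lp - n.+2%:R^-1 * lp.
    have /CQp/(_ i)/andP[yl yu] : C x by have [] := Dx 0%N.
    have yl' : zp i < rot_coord Q i x.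
      by rewrite lt_neqAle yl andbT; apply/eqP => h; apply: nf; exists i => //; left.
    have yu' : rot_coord Q i x < zp i + lp.
      by rewrite lt_neqAle yu andbT; apply/eqP => h; apply: nf; exists i => //; right.
    pose g := Num.min (rot_coord Q i x - zp i) (zp i + lp - rot_coord Q i x).
    have g0 : 0 < g by rewrite lt_min !subr_gt0 yl'.
    exists (Num.truncn (lp / g)) => n kn.
    have : n.+2%:R^-1 * lp <= g.
      rewrite mulrC ler_pdivrMr// mulrC -ler_pdivrMr//.
      apply: (le_trans (ltW (truncnS_gt _))); rewrite ler_nat ltnS.
      exact: (leq_trans kn).
    by rewrite le_min => /andP[h1 h2]; move: h1 h2; move: (_ * lp) => a; lra.
  have [k hk] := fin_all_exists gap.
  (* A point off all faces has a threshold for each coordinate; beyond their maximum it lies in the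
     core. *)
  have [_] := Dx (\max_i k i)%N I; apply => i.
  have := hk i (\max_i k i)%N (leq_bigmax i).
  move: (_ * lp) => a; lra.
have WD0 : W (\bigcap_n D n) = 0%E.
  apply/eqP; rewrite -measure_le0.
  apply: (le_trans (content_sub_fsum W finite_finset (fun i _ => mface i) mDI DI)).
  by rewrite fsbig1// => i _; exact: face0.
have : W \o D @ \oo --> 0%E.
  rewrite -WD0; apply: nonincreasing_cvg_mu => //.
    by apply: le_lt_trans Wfin; apply: le_measure; rewrite ?inE.
  by move=> m n mn; apply/subsetPset; apply: setDS; apply: core_le; exact: inv_le.
move=> /fine_cvgP[_ /cvgrPdist_le /(_ e e_gt0)[n _ /(_ n (leqnn n))]] /=.
have [w wE] := fin (mD n); rewrite wE /= sub0r normrN => we.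
exists n.+2%:R^-1; split; first by rewrite invr_gt0 ltr0n/= invf_lt1// ltr1n.
move=> t /andP[t0 tn]; apply: (@le_trans _ _ (W (D n))).
  apply: le_measure; rewrite ?inE//; last by apply: setDS; exact: core_le.
  by apply: measurableD => //; exact: measurable_rot_cube.
by rewrite wE lee_fin (le_trans _ we)// ler_norm.
Qed.

(* Two closed half-size cubes inside the inner cube always meet, so the two
   half-size corner cubes are first shrunk by the factor [1 - t]; the outer cubes
   are shrunk accordingly, by the homotheties of ratio [1 - t] centred at two
   opposite corners of the inner cube. *)
Lemma equal_cut (t : R) : 1 <= Rf -> lp / lm <= Rf -> 0 < t < 1 ->
  (0 < W (C `&` core t))%E ->
  exists X1 X2 : set pt,
    [/\ fat_pieces (2 * Rf) X1, fat_pieces (2 * Rf) X2, X1 `&` X2 = set0,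
        [/\ X1 `<=` C, X2 `<=` C & C `&` core t `<=` X1 `|` X2] & W X1 = W X2].
Proof.
move=> Rf1 lpm /andP[t0 t1] Wcore; have lm_gt0 := lm0.
(* Both sides carry the factor [1 - t], so [l / s] is exactly [2 * (lp / lm)]. *)
pose s := (1 - t) * lm / 2; pose l := (1 - t) * lp.
have s0 : 0 < s by rewrite /s divr_gt0// mulr_gt0// subr_gt0.
pose z1 := zm; pose z2 i := zm i + (lm - s).
(* [w1] and [w2] are the images of the corner [zp] under the homotheties of ratio [1 - t] centred at
   [zm] and at [zm + lm]. *)
pose w1 i := zm i + (1 - t) * (zp i - zm i).
pose w2 i := zm i + lm + (1 - t) * (zp i - zm i - lm).
pose Y1 := C `&` rot_cube Q w1 l; pose Y2 := C `&` rot_cube Q w2 l.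
have mY1 : measurable Y1 by apply: measurableI => //; exact: measurable_rot_cube.
have mY2 : measurable Y2 by apply: measurableI => //; exact: measurable_rot_cube.
have hs : s < lm / 2 by rewrite /s; nra.
have coreB x i : zp i + t * lp <= rot_coord Q i x <= zp i + t * lp + (lp - 2 * (t * lp)) ->
    w1 i <= rot_coord Q i x <= w1 i + l /\ w2 i <= rot_coord Q i x <= w2 i + l.
  have [c1 c2] := corner i; rewrite /w1 /w2 /l; move: (rot_coord Q i x) => y.
  move=> /andP[y1 y2]; split; apply/andP; split; nra.
have ls : l / s <= 2 * Rf.
  have -> : l / s = 2 * (lp / lm).
    by rewrite /l /s; field; rewrite !gt_eqF// subr_gt0.
  by rewrite ler_pM2l.
have QC1 : rot_cube Q z1 s `<=` Y1.
  move=> x hx; split.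
    by apply: mQC => i; have := hx i; rewrite /z1; lra.
  move=> i; have := hx i; have [c1 c2] := corner i; rewrite /w1 /l /z1.
  move: (rot_coord Q i x) => y /andP[y1 y2]; rewrite /s in y2.
  by apply/andP; split; nra.
have QC2 : rot_cube Q z2 s `<=` Y2.
  move=> x hx; split.
    by apply: mQC => i; have := hx i; rewrite /z2; lra.
  move=> i; have := hx i; have [c1 c2] := corner i; rewrite /w2 /l /z2.
  move: (rot_coord Q i x) => y /andP[y1 y2]; rewrite /s in y1 y2.
  by apply/andP; split; nra.
have Q12 : rot_cube Q z1 s `&` rot_cube Q z2 s = set0.
  rewrite -subset0 => x [/(_ (Ordinal d0)) + /(_ (Ordinal d0))].
  rewrite /z1 /z2; lra.
have coreY : C `&` core t `<=` Y1 `&` Y2.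
  move=> x [Cx cx]; split; split=> // i; have [] := coreB x i (cx i) => //.
have mcore : measurable (C `&` core t).
  by apply: measurableI => //; exact: measurable_rot_cube.
have WY1 : (0 < W Y1)%E.
  by apply: lt_le_trans Wcore _; apply: le_measure; rewrite ?inE// => x /coreY[].
have WY2 : (0 < W Y2)%E.
  by apply: lt_le_trans Wcore _; apply: le_measure; rewrite ?inE// => x /coreY[].
(* [Y1] and [Y2] overlap, so [W] alone does not express the balance. With this sum, [mu K = W Y2]
   reads [W (K & Y1) + W (K & Y2) = W Y2]; subtracting [W (K & Y2)] leaves
   [W (K & Y1) = W (Y2 - K)], the equality of the two pieces. *)
pose mu : {measure set pt -> \bar R} := measure_add (mrestr W mY1) (mrestr W mY2).
have muE A : mu A = (W (A `&` Y1) + W (A `&` Y2))%E by exact: measure_addE.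
have muT : (mu setT = W Y1 + W Y2)%E by rewrite muE !setTI.
have [r1 r1E] := fin mY1; have [r2 r2E] := fin mY2.
have mu0 A : measurable A -> W A = 0%E -> mu A = 0%E.
  move=> mA A0; rewrite muE; have sub0 B : measurable B -> W (A `&` B) = 0%E.
    move=> mB; apply: (subset_measure0 _ mA _ A0); last exact: subIsetl.
    exact: measurableI.
  by rewrite !sub0// adde0.
have [K [mK muK f1 f2]] : exists K : set pt, [/\ measurable K, mu K = W Y2,
    fat (2 * Rf) (K `&` Y1) & fat (2 * Rf) (Y2 `\` K)].
  apply: (@fat_cut _ _ mu _ _ M _ d0 Rf Q z1 z2 w1 w2 s l Y1 Y2 (W Y1) (W Y2)) => //.
  - by rewrite muT r1E r2E ltry.
  - by move=> q a hq; apply: mu0; [exact: measurable_hyperplane|exact: W_hyperplane].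
  - by apply: mu0 => //; apply: measurableC; exact: measurable_closed_box.
  - exact: subIsetr.
  - exact: subIsetr.
exists (K `&` Y1), (Y2 `\` K); split.
- by split=> //; exact: measurableI.
- by split=> //; exact: measurableD.
- by rewrite -subset0 => x [[Kx _] [_ /(_ Kx)]].
- split=> [x [_ []//]|x [[]//]|x /coreY[y1 y2]].
  by have [Kx|nKx] := pselect (K x); [left|right].
- have : W Y2 = (W (Y2 `\` K) + W (Y2 `&` K))%E by exact: measureDI.
  rewrite -{1}muK muE [Y2 `&` K]setIC.
  have [a ->] := fin (measurableI _ _ mK mY1); have [b ->] := fin (measurableI _ _ mK mY2).
  have [c ->] := fin (measurableD mY2 mK); by move=> -[/addIr ->].
Qed.

End Halving.

(** * The measure given by a non-negative density *)

Section DensityMeasure.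
Context dd (T : measurableType dd) (R : realType).
Variables (mu : {measure set T -> \bar R}) (f : T -> \bar R).
Hypotheses (mf : measurable_fun setT f) (f0 : forall x, (0 <= f x)%E).

(** The two proofs are arguments so that the measure structure can be attached to the set
    function. *)
Definition density_measure of measurable_fun setT f & (forall x, (0 <= f x)%E) :=
  fun A : set T => (\int[mu]_(x in A) f x)%E.

Local Notation nu := (density_measure mf f0).

Let nu0 : nu set0 = 0%E. Proof. exact: integral_set0. Qed.

Let nu_ge0 A : (0 <= nu A)%E. Proof. exact: integral_ge0. Qed.

Let nu_sigma_additive : semi_sigma_additive nu.
Proof. exact: semi_sigma_additive_nng_induced. Qed.

HB.instance Definition _ := isMeasure.Build _ _ _ nu nu0 nu_ge0 nu_sigma_additive.

End DensityMeasure.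

(** * Value measures as finite measures on the whole space *)

Section ValueMeasures.
Context (R : realType) (d : nat).
Local Notation pt := (d.-tuple R).
Variable lam : {measure set pt -> \bar R}.
Hypothesis lamL : is_lebesgue lam.
Variables (C : set pt) (M : R).
Hypothesis mC : measurable C.
Hypothesis CM : C `<=` closed_box (fun=> - M) (fun=> M).

(** The density is extended by zero outside [C]; sets null for [lam] stay null, in particular
    hyperplanes. *)
Lemma value_measure (v : pt -> R) : value_density lam C v ->
  exists W : {measure set pt -> \bar R},
    [/\ (W setT < +oo)%E,
        forall q a, (exists k, q k != 0) -> W (hyperplane q a) = 0%E,
        W (~` closed_box (fun=> - M) (fun=> M)) = 0%E &
        forall X, measurable X -> X `<=` C -> Val lam v X = W X].
Proof.
move=> [v0 _ iv _]; pose f := (EFin \o v) \_ C.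
have mf : measurable_fun setT f.
  by apply/(measurable_restrictT _ mC); exact: (measurable_int lam iv).
have f0 x : (0 <= f x)%E.
  by rewrite /f patchE; case: ifPn => //; rewrite inE => Cx; rewrite lee_fin v0.
exists (density_measure lam mf f0); split.
- by rewrite /= /density_measure -integral_mkcond; exact: integrable_lty.
- move=> q a hq; apply: null_set_integral; first exact: measurable_hyperplane.
    exact: measurable_funTS.
  exact: hyperplane_null.
- apply: integral0_eq => x nBx; rewrite /f patchE memNset// => /CM; exact: nBx.
- move=> X mX XC; apply: eq_integral => x; rewrite inE => Xx.
  by rewrite /f patchE mem_set//; exact: XC.
Qed.

(** [is_lebesgue] gives volumes of axis-parallel boxes, so a small one is inscribed around the
    centre of the rotated cube. *)
Lemma rot_cube_gt0 (Q : 'M[R]_d) z l : @Defs.orthonormal R d Q -> 0 < l ->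
  (0 < lam (rot_cube Q z l))%E.
Proof.
move=> QQ l0; have [x0 [_ x0E]] := rot_coord_surj (\row_i (z i + l / 2)) QQ.
(* [S] bounds every absolute row sum of [Q], so moving each coordinate by at most [l / 2 / S]
   changes a rotated coordinate by at most [l / 2]; the summand 1 keeps [S] positive. *)
pose S := 1 + \sum_i \sum_j `|Q i j|.
have S1 : 1 <= S by rewrite lerDl sumr_ge0// => i _; rewrite sumr_ge0.
pose r := l / 2 / S.
have r0 : 0 < r by rewrite !divr_gt0//; lra.
have sub : closed_box (fun i => tnth x0 i - r) (fun i => tnth x0 i + r) `<=` rot_cube Q z l.
  move=> x hx i.
  have : `|rot_coord Q i x - rot_coord Q i x0| <= l / 2.
    rewrite /rot_coord -sumrB; apply: (le_trans (ler_norm_sum _ _ _)).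
    apply: (@le_trans _ _ (\sum_j `|Q i j| * r)).
      apply: ler_sum => j _; rewrite -mulrBr normrM ler_wpM2l//.
      by rewrite ler_norml; have := hx j; lra.
    rewrite -mulr_suml /r mulrA ler_pdivrMr; last lra.
    rewrite mulrC ler_wpM2l//; first lra.
    rewrite /S [X in _ <= 1 + X](bigD1 i)//= addrCA lerDl addr_ge0//.
    by rewrite sumr_ge0// => k _; rewrite sumr_ge0.
  by rewrite x0E mxE ler_norml; lra.
have mB : measurable (closed_box (fun i => tnth x0 i - r) (fun i => tnth x0 i + r)).
  exact: measurable_closed_box.
apply: (@lt_le_trans _ _ (lam (closed_box (fun i => tnth x0 i - r) (fun i => tnth x0 i + r)))).
  rewrite lebesgue_closed_box//; last by move=> i; lra.
  by rewrite lte_fin prodr_gt0// => i _; lra.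
by apply: le_measure; rewrite ?inE//; exact: measurable_rot_cube.
Qed.

Lemma value_density1 : (0 < lam C)%E -> value_density lam C (fun=> 1).
Proof.
move=> C0.
have lamC : (lam C < +oo)%E.
  have mB : measurable (closed_box (fun=> - M) (fun=> M) : set pt) by exact: measurable_closed_box.
  apply: (@le_lt_trans _ _ (lam (closed_box (fun=> - M) (fun=> M)))).
    by apply: le_measure; rewrite ?inE.
  have [M0|M0] := leP 0 M; first by rewrite lebesgue_closed_box ?ltry// => i; lra.
  (* For [M < 0] the box is empty, except in dimension 0, where it is the whole one-point space. *)
  have [d0|d0] := posnP d.
    subst d; rewrite (_ : closed_box _ _ = closed_box (fun=> 0) (fun=> 0)).
      by rewrite lebesgue_closed_box ?ltry.
    by apply/seteqP; split=> x _ [].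
  rewrite (_ : closed_box _ _ = set0) ?measure0// -subset0 => x /(_ (Ordinal d0)); lra.
split=> //; first by exists 1.
- apply/integrableP; split; first exact: measurable_cst.
  under eq_integral do rewrite /= normr1.
  by rewrite integral_cst// mul1e.
- by rewrite integral_cst// mul1e.
Qed.

Variable Rf : R.
Let S := fat_pieces (d := d) (2 * Rf).

(** An admissible piece attains its own supremum, by monotonicity. Envy between such pieces thus
    reduces to comparing measures. *)
Lemma ValSE (v : pt -> R) (W : {measure set pt -> \bar R}) X :
  (forall X, measurable X -> X `<=` C -> Val lam v X = W X) ->
  S X -> X `<=` C -> ValS lam S v X = W X.
Proof.
move=> vW SX XC; apply/eqP; rewrite eq_le; apply/andP; split.
  apply: ge_ereal_sup => _ [s [Ss sX] <-]; have [ms _] := Ss; have [mX _] := SX.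
  rewrite vW//; last exact: subset_trans XC.
  by apply: le_measure; rewrite ?inE.
by apply: ereal_sup_ubound; exists X; [split|rewrite vW//; case: SX].
Qed.

End ValueMeasures.

(** * Cut and choose for two agents, and the matching upper bound *)

Section TwoAgents.
Context (R : realType) (d : nat).
Local Notation pt := (d.-tuple R).
Variable lam : {measure set pt -> \bar R}.
Hypotheses (lamL : is_lebesgue lam) (d0 : (0 < d)%N).
Variables (C : set pt) (M Rf : R).
Hypotheses (mC : measurable C) (CM : C `<=` closed_box (fun=> - M) (fun=> M)).
Hypotheses (Rf1 : 1 <= Rf) (fC : fat Rf C).
Local Notation S := (fat_pieces (d := d) (2 * Rf)).

Let ord1P (i : 'I_2) : i != ord0 -> i = ord_max.
Proof. by case: i => [[|[|//]]] // hi _; apply: val_inj. Qed.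

Lemma envy_free_allocation (v : 'I_2 -> pt -> R) (e : R) :
  (forall i, value_density lam C (v i)) -> 0 < e ->
  exists X, [/\ allocation C S X, envy_free lam S v X &
    ((1 / 2 - e)%:E <= min_ratio lam C v X)%E].
Proof.
move=> vd e0.
have /fin_all_exists [W hW] := fun i => value_measure lamL mC CM (vd i).
have vW i X : measurable X -> X `<=` C -> Val lam (v i) X = W i X.
  by have [_ _ _] := hW i; apply.
have fin i X : measurable X -> exists r, W i X = r%:E.
  by have [Wfin _ _ _] := hW i; exact: finite_measure_EFin Wfin.
have [V VE] := fin_all_exists (fun i => fin i C mC).
have V0 i : 0 < V i.
  by have [_ _ _] := vd i; rewrite -[X in (0 < X)%E]/(Val lam (v i) C) vW// VE lte_fin.
have [Q [zm [zp [lm [lp [QQ lm0 mQC CQp lpm]]]]]] := (fatP Rf C).1 fC.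
(* The cap [1/4] keeps the value of the core positive, as [equal_cut] requires. *)
pose e' := Num.min e (1 / 4).
have e'0 : 0 < e' by rewrite lt_min e0; lra.
have e'e : e' <= e by rewrite ge_min lexx.
have e'1 : e' <= 1 / 4 by rewrite ge_min lexx orbT.
have waste i : exists t, 0 < t < 1 /\ forall s, 0 < s <= t ->
    (W i (C `\` core Q zp lp s) <= (e' * V i)%:E)%E.
  have [Wfin Wh _ _] := hW i.
  by apply: (core_waste Wfin Wh d0 QQ lm0 mC mQC CQp); rewrite mulr_gt0.
have [t ht] := fin_all_exists waste.
(* One margin serves both agents, since the waste bound holds for all smaller margins. *)
pose s := Num.min (t ord0) (t ord_max).
have s01 : 0 < s < 1.
  have [/andP[a b] _] := ht ord0; have [/andP[a' b'] _] := ht ord_max.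
  by rewrite lt_min a a' gt_min b.
have mK : measurable (core Q zp lp s) by exact: measurable_rot_cube.
have Wcore i : ((V i - e' * V i)%:E <= W i (C `&` core Q zp lp s))%E.
  have [_ /(_ s)] := ht i.
  have st : s <= t i.
    have [->|/ord1P ->] := eqVneq i ord0; first by rewrite ge_min lexx.
    by rewrite ge_min lexx orbT.
  have /andP[-> _] := s01 => /(_ st).
  have : W i C = (W i (C `\` core Q zp lp s) + W i (C `&` core Q zp lp s))%E.
    exact: measureDI.
  rewrite VE; have [a ->] := fin i _ (measurableD mC mK).
  have [b ->] := fin i _ (measurableI _ _ mC mK).
  by move=> [->]; rewrite !lee_fin; lra.
(* Agent [ord0] cuts and is indifferent; agent [ord_max] receives the preferred piece, called
   [B]. *)
suff claim A B : S A -> S B -> A `&` B = set0 -> A `<=` C -> B `<=` C ->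
    C `&` core Q zp lp s `<=` A `|` B -> W ord0 A = W ord0 B ->
    (W ord_max A <= W ord_max B)%E ->
    exists X, [/\ allocation C S X, envy_free lam S v X &
      ((1 / 2 - e)%:E <= min_ratio lam C v X)%E].
  have [Wfin Wh WM _] := hW ord0.
  have Wc0 : (0 < W ord0 (C `&` core Q zp lp s))%E.
    apply: lt_le_trans (Wcore ord0); rewrite lte_fin; have := V0 ord0; nra.
  have [A [B [fA fB AB [AC BC ABc] WAB]]] :=
    equal_cut Wfin Wh WM d0 QQ lm0 mC mQC CQp Rf1 lpm s01 Wc0.
  have [h|/ltW h] := leP (W ord_max A) (W ord_max B).
    exact: (claim A B).
  by apply: (claim B A) => //; [rewrite setIC|rewrite setUC].
move=> SA SB AB AC BC ABc WAB W1; have [mA _] := SA; have [mB _] := SB.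
pose X (i : 'I_2) := if i == ord0 then A else B.
have SX i : S (X i) by rewrite /X; case: ifP.
have XC i : X i `<=` C by rewrite /X; case: ifP.
have best i j : (W i (X j) <= W i (X i))%E.
  have [->|/ord1P ->] := eqVneq i ord0; rewrite /X /=.
    by case: ifP => // _; rewrite WAB.
  by case: ifP.
exists X; split.
- split=> // i j ij; rewrite /X; have [i0|i0] := eqVneq i ord0.
    by rewrite i0 eq_sym in ij; rewrite (negbTE ij).
  by rewrite (ord1P i0) in ij; rewrite (_ : j = ord0) ?eqxx 1?setIC//;
     apply/eqP; apply: contraTT ij => /ord1P ->; rewrite eqxx.
- by move=> i j; rewrite !(ValSE (W := W i) (vW i)).
- apply: le_ereal_inf_tmp => _ [i _ <-]; rewrite lee_fin.
  have [mXi _] := SX i.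
  rewrite !vW// VE /= ler_pdivlMr//.
  have [a aE] := fin i _ mA; have [b bE] := fin i _ mB.
  (* The pieces cover the core, and each agent holds a piece of maximal value to them, hence at
     least half of [(1 - e') * V i]. *)
  have ab : V i - e' * V i <= a + b.
    rewrite -lee_fin [leRHS]EFinD -aE -bE; apply: (le_trans (Wcore i)).
    apply: le_trans (measureU2 _ mA mB); apply: le_measure; rewrite ?inE//.
      exact: measurableI.
    exact: measurableU.
  have eV : e' * V i <= e * V i by rewrite ler_pM2r.
  have eV0 : 0 <= e * V i by rewrite mulr_ge0 ?ltW.
  have aX : (W i A <= W i (X i))%E by exact: (best i ord0).
  have bX : (W i B <= W i (X i))%E by exact: (best i ord_max).
  move: aX bX; rewrite aE bE; have [r ->] := fin i _ mXi.
  by rewrite !lee_fin /= => ar br; rewrite mulrBl; lra.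
Qed.

(** Stated for any condition implied by envy-freeness, so that it covers [PropEF] and [PropAll]
    together. *)
Lemma PropGen_ge (P : forall n, ('I_n -> pt -> R) -> ('I_n -> set pt) -> Prop) :
  (forall v X, envy_free lam S v X -> P 2 v X) ->
  ((1 / 2)%:E <= PropGen lam P C 2 S)%E.
Proof.
move=> EP; apply: le_ereal_inf_tmp => _ [v vd <-].
apply/lee_addgt0Pr => e e0.
have [X [aX eX rX]] := envy_free_allocation vd e0.
rewrite -leeBlDr// -EFinB; apply: (le_trans rX); apply: ereal_sup_ubound.
by exists X => //; split=> //; exact: EP.
Qed.

(** When both agents have the constant density 1, the two disjoint pieces share the value of [C], so
    the smaller one gets at most half. *)
Lemma PropGen_le (P : forall n, ('I_n -> pt -> R) -> ('I_n -> set pt) -> Prop) :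
  (PropGen lam P C 2 S <= (1 / 2)%:E)%E.
Proof.
have [Q [zm [zp [lm [lp [QQ lm0 mQC CQp lpm]]]]]] := (fatP Rf C).1 fC.
have C0 : (0 < lam C)%E.
  apply: lt_le_trans (rot_cube_gt0 lamL zm QQ lm0) _.
  by apply: le_measure; rewrite ?inE//; exact: measurable_rot_cube.
have vd := value_density1 lamL mC CM C0.
have [W [Wfin _ _ vW]] := value_measure lamL mC CM vd.
have fin X : measurable X -> exists r, W X = r%:E.
  exact: finite_measure_EFin Wfin.
have [V VE] := fin C mC.
have V0 : 0 < V.
  by have [_ _ _] := vd; rewrite -[X in (0 < X)%E]/(Val lam (fun=> 1) C) vW// VE lte_fin.
pose v (i : 'I_2) (x : pt) : R := 1.
apply: (@le_trans _ _ (ereal_sup [set min_ratio lam C v X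
    | X in [set X | allocation C S X /\ P 2 v X]])).
  by apply: ereal_inf_lbound; exists v.
apply: ge_ereal_sup => _ [X [[SX XX XC] _] <-].
have [m0 _] := SX ord0; have [m1 _] := SX ord_max.
have [a aE] := fin _ m0; have [b bE] := fin _ m1.
have ratio i : (min_ratio lam C v X <= (fine (W (X i)) / V)%:E)%E.
  apply: ereal_inf_lbound; exists i => //; have [mi _] := SX i.
  by rewrite !vW// VE.
have abV : a + b <= V.
  rewrite -lee_fin EFinD -aE -bE -VE -measureU//; last exact: XX.
  apply: le_measure; rewrite ?inE//; first exact: measurableU.
  by move=> x [/XC|/XC].
have [ab|ba] := leP a b.
  apply: (le_trans (ratio ord0)); rewrite aE lee_fin ler_pdivrMr//=; lra.
apply: (le_trans (ratio ord_max)); rewrite bE lee_fin ler_pdivrMr//=; lra.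
Qed.

End TwoAgents.

Theorem theorem1 (R : realType) (d : nat)
    (lam : {measure set (d.-tuple R) -> \bar R}) (Rf : R)
    (C : set (d.-tuple R)) :
  (2 <= d)%N -> is_lebesgue lam -> 1 <= Rf ->
  measurable C -> bounded_piece C -> fat Rf C ->
  PropEF lam C 2 (fat_pieces (2 * Rf)) = (1 / 2)%:E /\
  PropAll lam C 2 (fat_pieces (2 * Rf)) = (1 / 2)%:E.
Proof.
move=> d2 lamL Rf1 mC [M CM] fC; have d0 : (0 < d)%N by exact: ltn_trans d2.
have CB : C `<=` closed_box (fun=> - M) (fun=> M).
  by move=> x Cx i; rewrite -ler_norml; exact: CM.
by split; apply/eqP; rewrite eq_le (PropGen_le lamL mC CB fC)
  (PropGen_ge lamL d0 mC CB Rf1 fC).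
Qed.
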